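(* Let $D\subseteq\mathbb{C}^n$ be a bounded domain and let $\Omega_1,\Omega_2\subseteq\mathbb{C}^n$ be bounded, balanced, convex domains. For $i=1,2$ put $\alpha_i=\mathrm{dist}(0,\partial\Omega_i)$ and $R_i=\tfrac12\,\mathrm{diam}(\Omega_i)$. Then for every $a\in D$ the following hold: (1) $S_D^{\Omega_2}(a)\ \ge\ \dfrac{\alpha_1\alpha_2}{R_1R_2}\,S_D^{\Omega_1}(a)$; (2) $S_D^{\Omega_1}(a)\ \ge\ \dfrac{\alpha_1\alpha_2}{R_1R_2}\,S_D^{\Omega_2}(a)$.
   Context: A domain $\Omega\subseteq\mathbb{C}^n$ is balanced if $\lambda z\in\Omega$ for every $z\in\Omega$ and every $\lambda\in\mathbb{C}$ with $|\lambda|\le 1$. Its Minkowski function is $h_\Omega(z)=\inf\{t>0:\ z/t\in\Omega\}$ for $z\in\mathbb{C}^n$, and for $0<r\le 1$ we put $\Omega(r)=\{z\in\mathbb{C}^n: h_\Omega(z)<r\}$. For domains $D,\Omega\subseteq\mathbb{C}^n$, $\mathcal{O}_u(D,\Omega)$ denotes the set of all injective holomorphic maps from $D$ into $\Omega$. Distances and diameters are Euclidean. For a bounded domain $D\subseteq\mathbb{C}^n$, a bounded, balanced, convex domain $\Omega\subseteq\mathbb{C}^n$ and $z\in D$, the generalized squeezing function is $$S_D^{\Omega}(z)=\sup\{r:\ \Omega(r)\subseteq f(D)\ \text{for some}\ f\in\mathcal{O}_u(D,\Omega)\ \text{with}\ f(z)=0\}.$$ *)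

(* Defs.v *)
From HB Require Import structures.
From mathcomp Require Import all_boot all_order all_algebra.
From mathcomp Require Import complex.
From mathcomp Require Import all_classical all_reals all_analysis.

Set Implicit Arguments.
Unset Strict Implicit.
Unset Printing Implicit Defensive.

Import Order.TTheory GRing.Theory Num.Theory.
Import numFieldNormedType.Exports.

Local Open Scope classical_set_scope.
Local Open Scope ring_scope.
Local Open Scope complex_scope.

(* The complex numbers as a [numFieldType]: unlike the bare type [R[i]], [CC R]
   carries the topology of its absolute value, and ['rV[CC R]_n] is then a normed
   module over [CC R].  The norm [`|z|] on ['rV[CC R]_n] is the maximum norm; it
   is used only through the topology and the bounded sets it induces, metric
   quantities being defined from [enorm]. *)
Definition CC (R : realType) : numFieldType := R[i].

Section euclidean.
Context {R : realType} {n : nat}.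
Implicit Types (z w : 'rV[CC R]_n) (A B : set 'rV[CC R]_n).

Definition enorm z : R := Num.sqrt (\sum_(i < n) Normc.normc (z ord0 i) ^+ 2).

Definition set_dist z A : R := inf [set enorm (z - w) | w in A].

Definition set_diam A : R :=
  sup [set d | exists z w, [/\ A z, A w & d = enorm (z - w)]].

Definition set_boundary A := closure A `\` A°.

Definition is_domain A := [/\ A !=set0, open A & connected A].

Definition balanced A :=
  forall z (l : CC R), A z -> `|l| <= 1 -> A (l *: z).

End euclidean.

Section squeezing.
Context {R : realType} {n : nat}.
Implicit Types (z : 'rV[CC R]_n) (D Omega : set 'rV[CC R]_n).

Definition minkowski Omega z : R :=
  inf [set t : R | 0 < t /\ Omega ((t%:C)^-1 *: z)].

Definition minkowski_ball Omega (r : R) : set 'rV[CC R]_n :=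
  [set z | minkowski Omega z < r].

(* [differentiable] is over the scalars [CC R], hence complex differentiability.
   Maps out of [D] are total functions constrained only on the open set [D]. *)
Definition inj_holomorphic D Omega : set ('rV[CC R]_n -> 'rV[CC R]_n) :=
  [set f | [/\ forall z, D z -> differentiable f z,
               set_inj D f
             & f @` D `<=` Omega]].

(* The side condition on [r] is the range in which [Omega(r)] is considered. *)
Definition squeezing D Omega z : R :=
  sup [set r : R | 0 < r <= 1 /\
    exists f, [/\ inj_holomorphic D Omega f, f z = 0
                & minkowski_ball Omega r `<=` f @` D]].

End squeezing.

(* Main.v *)
Require Import Defs.
From HB Require Import structures.
From mathcomp Require Import all_boot all_order all_algebra.
From mathcomp Require Import complex.
From mathcomp Require Import all_classical all_reals all_analysis.
From mathcomp Require Import ring lra.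

Import Order.TTheory GRing.Theory Num.Theory.
Import numFieldNormedType.Exports.

Local Open Scope classical_set_scope.
Local Open Scope ring_scope.

(** Write [al_i] and [R_i] for the distance from the
    origin to the boundary of [Omega_i] and for half its diameter.  A bounded
    balanced open set [Omega] is trapped between two Euclidean balls centred at the
    origin.  It contains the open ball of radius [al], since on the segment from
    [0] to a point outside [Omega] one meets the boundary ([mem_of_enorm_lt]),
    and it lies in the open ball of radius [R], since with [z] it contains
    [-(1+e) z] and [(1+e) z] for some [e > 0] ([enorm_lt_half_diam]).

    Let [f] be injective and holomorphic from [D] to [Omega_1], with [f a = 0]
    and image containing [Omega_1(r)].  Shrink it to [g = (al_2 / R_1) f].
    As [|f| < R_1], the values of [g] have norm less than [al_2] and so lie in
    [Omega_2].  If [z] is in [Omega_2(s)] then [|z| < s R_2], so the point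
    [(R_1 / al_2) z] has norm less than [s R_1 R_2 / al_2], which for
    [s = al_1 al_2 r / (R_1 R_2)] is [al_1 r]; it is therefore in
    [Omega_1(r)], hence in the image of [f], and [z] is in the image of [g].
    Thus every radius [r] admissible for [Omega_1] yields the radius [s]
    admissible for [Omega_2] ([squeezing_radius_transfer]), and the first
    inequality follows on taking suprema ([squeezing_comparison]).  The second
    is the first with the two model domains exchanged. *)

(** A real number as a scalar of [CC R] rather than of the bare [R[i]], so that
    multiples of a vector live in the normed module where neighbourhoods are
    taken. *)
Local Notation "s %:CC" := (real_complex _ s : CC _)
  (at level 1, left associativity).

(** * Euclidean norm and real scalings *)

Section EuclideanNorm.
Context {R : realType} {n : nat}.
Implicit Types (z w : 'rV[CC R]_n) (A : set 'rV[CC R]_n) (s t : R).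

Local Open Scope complex_scope.

Lemma normc_normr (x : CC R) : `|x| = (Normc.normc x)%:C.
Proof. by case: x. Qed.

Lemma normc_ge0 (x : CC R) : 0 <= Normc.normc x.
Proof. by case: x => u v; exact: sqrtr_ge0. Qed.

Lemma normr_real s : `|s%:CC| = `|s|%:C.
Proof. by rewrite normc_normr /= expr0n /= addr0 sqrtr_sqr. Qed.

Lemma enorm_ge0 z : 0 <= enorm z.
Proof. exact: sqrtr_ge0. Qed.

Lemma enormZ s z : enorm (s%:CC *: z) = `|s| * enorm z.
Proof.
rewrite /enorm -sqrtr_sqr -sqrtrM ?sqr_ge0// mulr_sumr.
congr Num.sqrt; apply: eq_bigr => i _.
rewrite mxE Normc.normcM exprMn /= expr0n /= addr0.
by rewrite sqr_sqrtr ?sqr_ge0.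
Qed.

Lemma enormN z : enorm (- z) = enorm z.
Proof.
have -> : - z = (-1)%:CC *: z by rewrite rmorphN1 scaleN1r.
by rewrite enormZ normrN1 mul1r.
Qed.

Lemma scale_realA s t z : s%:CC *: (t%:CC *: z) = (s * t)%:CC *: z.
Proof. by rewrite scalerA -rmorphM. Qed.

Lemma normr_coord_le z (i : 'I_n) : `|z ord0 i| <= `|z|.
Proof.
rewrite [leRHS]/Num.norm /= mx_normE.
have -> : `|z ord0 i| = (`|z ord0 i|%:nng : {nonneg CC R})%:num by [].
rewrite num_le.
by apply/bigmax_geP; right => /=; exists (ord0, i).
Qed.

(** Boundedness refers to the maximum norm; it makes the supremum defining the
    Euclidean diameter a genuine one. *)
Lemma has_ubound_diam A : bounded_set A ->
  has_ubound [set d | exists z w, [/\ A z, A w & d = enorm (z - w)]].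
Proof.
move=> [M [Mreal bM]].
have {}bM z : A z -> `|z| <= M + 1 by apply: bM; rewrite ltrDl.
exists (Num.sqrt (\sum_(i < n) complex.Re (M + 1 + (M + 1)) ^+ 2)).
move=> _ [z [w [Az Aw ->]]].
apply: ler_wsqrtr; apply: ler_sum => i _.
have : `|(z - w) ord0 i| <= M + 1 + (M + 1).
  apply: (le_trans (normr_coord_le _ _)).
  by apply: (le_trans (ler_normB _ _)); apply: lerD; exact: bM.
rewrite normc_normr lecE => /andP[_ /= le_i].
have ge0 := normc_ge0 ((z - w) ord0 i).
by rewrite ler_sqr ?nnegrE// (le_trans ge0).
Qed.

Lemma nbhs_ray z t (U : set 'rV[CC R]_n) : nbhs (t%:CC *: z) U ->
  exists2 e : R, 0 < e & forall s, `|s - t| < e -> U (s%:CC *: z).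
Proof.
move=> /(@scalel_continuous _ _ z (t%:CC)) /nbhs_ballP [e /= e0 sub].
move: e0; rewrite ltcE /= => /andP[/eqP Ime Ree].
exists (complex.Re e) => // s st; apply: sub.
rewrite -ball_normE /ball_ /= -rmorphB normr_real distrC.
by rewrite ltcE /= Ime eqxx.
Qed.

End EuclideanNorm.

(** * A balanced open set between two balls *)

Section BalancedBalls.
Context {R : realType} {n : nat}.
Implicit Types (z : 'rV[CC R]_n) (A : set 'rV[CC R]_n) (s t : R).

Local Open Scope complex_scope.

Lemma balanced0 {A} : balanced A -> A !=set0 -> A 0.
Proof.
by move=> balA [z Az]; rewrite -(scale0r z); apply: balA; rewrite ?normr0.
Qed.

Lemma set_dist_ge0 z A : 0 <= set_dist z A.
Proof.
rewrite /set_dist; set E := (X in inf X).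
have [->|/set0P E0] := eqVneq E set0; first by rewrite inf0.
by apply: lb_le_inf => // _ [w _ <-]; exact: enorm_ge0.
Qed.

(** If [z] is outside [A], the supremum [T] of the parameters [t] in [[0, 1]]
    with [t z] in [A] gives a boundary point [T z], no further from the origin
    than [z]. *)
Lemma mem_of_enorm_lt A z : balanced A -> A !=set0 ->
  enorm z < set_dist 0 (set_boundary A) -> A z.
Proof.
move=> balA A0 zlt; apply: contrapT => nAz.
pose E := [set t | 0 <= t <= 1 /\ A (t%:CC *: z)].
have E0 : E 0 by split; rewrite ?lexx ?ler01// scale0r; exact: balanced0.
have ubE : ubound E 1 by move=> t [/andP[]].
have supE : has_sup E by split; [exists 0|exists 1].
have T0 : 0 <= sup E by apply: ub_le_sup => //; exists 1.
have T1 : sup E <= 1 by apply: ge_sup => //; exists 0.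
have bdT : set_boundary A ((sup E)%:CC *: z).
  split.
    move=> U /nbhs_ray [e e0 eU].
    have [t Et tT] := sup_adherent e0 supE.
    exists (t%:CC *: z); split; first by case: Et.
    apply: eU; have /= tT' := ub_le_sup (proj2 supE) Et.
    by rewrite distrC ger0_norm ?subr_ge0// ltrBlDl -ltrBlDr.
  move=> /nbhs_ray [e e0 eA].
  have [T1'|T1'] := leP 1 (sup E + e / 2).
    apply: nAz; rewrite -(scale1r z); apply: (eA 1).
    by rewrite ger0_norm ?subr_ge0//; lra.
  have : E (sup E + e / 2).
    split; first by apply/andP; split; lra.
    by apply: eA; rewrite addrC addKr ger0_norm; lra.
  by move=> /(ub_le_sup (proj2 supE)); lra.
move: zlt; rewrite ltNge => /negP; apply.
apply: (@le_trans _ _ (enorm (0 - (sup E)%:CC *: z))).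
  apply: ge_inf; last by exists ((sup E)%:CC *: z).
  by exists 0 => _ [w _ <-]; exact: enorm_ge0.
by rewrite sub0r enormN enormZ ger0_norm// ler_piMl// enorm_ge0.
Qed.

(** Openness makes the inequality strict: the diameter is at least the distance
    between [t z] and [- t z] for some [t > 1]. *)
Lemma enorm_lt_half_diam A z : bounded_set A -> balanced A -> open A ->
  0 < 2^-1 * set_diam A -> A z -> enorm z < 2^-1 * set_diam A.
Proof.
move=> bndA balA openA diam_gt0 Az.
have [z0|z0] := eqVneq (enorm z) 0; first by rewrite z0.
have {}z0 : 0 < enorm z by rewrite lt_def z0 enorm_ge0.
have : nbhs (1%:CC *: z) A by rewrite scale1r; apply: open_nbhs_nbhs.
move=> /nbhs_ray [e e0 eA].
pose t := 1 + e / 2.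
have At : A (t%:CC *: z).
  by apply: eA; rewrite /t addrC addKr ger0_norm; lra.
have ANt : A (- (t%:CC *: z)).
  by rewrite -scaleN1r; apply: balA => //; rewrite normrN1.
have : enorm (t%:CC *: z - - (t%:CC *: z)) <= set_diam A.
  apply: ub_le_sup; first exact: has_ubound_diam.
  by exists (t%:CC *: z), (- (t%:CC *: z)).
have -> : t%:CC *: z - - (t%:CC *: z) = (t + t)%:CC *: z.
  by rewrite opprK -scalerDl -rmorphD.
rewrite enormZ ger0_norm; last by rewrite /t; lra.
have : 0 < e * enorm z by rewrite mulr_gt0.
rewrite /t; lra.
Qed.

(** This is what keeps the constant of the comparison at most [1], hence every
    transferred radius in the range [(0, 1]]. *)
Lemma dist_boundary_le_half_diam A : (0 < n)%N ->
  bounded_set A -> balanced A -> open A -> A !=set0 ->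
  0 < 2^-1 * set_diam A -> set_dist 0 (set_boundary A) <= 2^-1 * set_diam A.
Proof.
move=> n_gt0 bndA balA openA A0 diam_gt0; rewrite leNgt; apply/negP => lt_dist.
pose u : 'rV[CC R]_n := const_mx 1.
have u_gt0 : 0 < enorm u.
  rewrite /enorm sqrtr_gt0 (bigD1 (Ordinal n_gt0))//= mxE.
  rewrite Normc.normc1 expr1n ltr_pwDl// sumr_ge0// => i _.
  exact: sqr_ge0.
pose z := ((2^-1 * set_diam A) / enorm u)%:CC *: u.
have zE : enorm z = 2^-1 * set_diam A.
  by rewrite enormZ ger0_norm ?divr_ge0 ?enorm_ge0 ?(ltW diam_gt0)//
    divfK ?gt_eqF.
have Az : A z by apply: mem_of_enorm_lt => //; rewrite zE.
by have := enorm_lt_half_diam _ _ bndA balA openA diam_gt0 Az; rewrite zE ltxx.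
Qed.

Lemma minkowski_lt A z s : balanced A -> A !=set0 ->
  enorm z < s * set_dist 0 (set_boundary A) -> Defs.minkowski A z < s.
Proof.
move=> balA A0; set al := set_dist _ _ => zs.
have z_ge0 := enorm_ge0 z.
have al_gt0 : 0 < al.
  rewrite lt_def set_dist_ge0 andbT; apply: contraTneq zs => ->.
  by rewrite mulr0 ltNge z_ge0.
have q_lt : enorm z / al < s by rewrite ltr_pdivrMr.
have q_ge0 : 0 <= enorm z / al by exact: divr_ge0 z_ge0 (ltW al_gt0).
pose t := (enorm z / al + s) / 2.
have t_gt : enorm z / al < t by rewrite /t; lra.
have t_gt0 : 0 < t by lra.
apply: (@le_lt_trans _ _ t); last by rewrite /t; lra.
apply: ge_inf; first by exists 0 => y [/ltW].
split => //; rewrite -fmorphV; apply: mem_of_enorm_lt => //.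
rewrite enormZ gtr0_norm ?invr_gt0// mulrC ltr_pdivrMr//.
by rewrite mulrC -ltr_pdivrMr.
Qed.

(** The positivity of the inner radius guarantees that some multiple of [z] lies
    in [A], so that the infimum defining the Minkowski function is not the
    default value [0] taken on the empty set. *)
Lemma enorm_lt_of_minkowski_lt A z s : bounded_set A -> balanced A -> open A ->
  A !=set0 -> 0 < set_dist 0 (set_boundary A) -> 0 < 2^-1 * set_diam A ->
  Defs.minkowski A z < s -> enorm z < s * (2^-1 * set_diam A).
Proof.
move=> bndA balA openA A0 al_gt0 diam_gt0.
rewrite /Defs.minkowski; set E := (X in inf X) => infs.
have z_ge0 := enorm_ge0 z.
have E0 : E !=set0.
  set al := set_dist _ _ in al_gt0.
  have t_gt0 : 0 < (enorm z + 1) / al by rewrite divr_gt0// ltr_wpDl.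
  exists ((enorm z + 1) / al); split => //.
  rewrite -fmorphV; apply: mem_of_enorm_lt => //.
  rewrite enormZ gtr0_norm ?invr_gt0// mulrC ltr_pdivrMr//.
  by rewrite mulrC divfK ?gt_eqF// ltrDl.
have [t [t_gt0 At] ts] : exists2 t, E t & t < s by apply: inf_lt.
apply: (@lt_trans _ _ (t * (2^-1 * set_diam A))); last by rewrite ltr_pM2r.
have := enorm_lt_half_diam _ _ bndA balA openA diam_gt0 At.
by rewrite -fmorphV enormZ gtr0_norm ?invr_gt0// mulrC ltr_pdivrMr// mulrC.
Qed.

End BalancedBalls.

(** * Comparison of squeezing functions *)

Section Comparison.
Context {R : realType} {n : nat}.
Implicit Types (D Omega : set 'rV[CC R]_n) (a : 'rV[CC R]_n) (r c : R).

Local Open Scope complex_scope.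

Definition squeezing_radius D Omega a : set R :=
  [set r | 0 < r <= 1 /\
    exists f, [/\ inj_holomorphic D Omega f, f a = 0
                & minkowski_ball Omega r `<=` f @` D]].

Lemma squeezing_ge0 D Omega a : 0 <= squeezing D Omega a.
Proof.
rewrite /squeezing -/(squeezing_radius D Omega a).
have [->|/set0P[r Er]] := eqVneq (squeezing_radius D Omega a) set0.
  by rewrite sup0.
apply: (@le_trans _ _ r); first by case: Er => /andP[/ltW].
by apply: ub_le_sup => //; exists 1 => t [/andP[]].
Qed.

(** Scaling [f] by [al2 / R1] fits its image, contained in the ball of radius
    [R1], into the ball of radius [al2] inside [Omega2]. *)
Lemma squeezing_radius_transfer D Omega1 Omega2 a r : (0 < n)%N ->
  open Omega1 -> bounded_set Omega1 -> balanced Omega1 -> Omega1 !=set0 ->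
  open Omega2 -> bounded_set Omega2 -> balanced Omega2 -> Omega2 !=set0 ->
  let al1 := set_dist 0 (set_boundary Omega1) in
  let al2 := set_dist 0 (set_boundary Omega2) in
  let R1 := 2^-1 * set_diam Omega1 in
  let R2 := 2^-1 * set_diam Omega2 in
  0 < al1 -> 0 < al2 -> 0 < R1 -> 0 < R2 ->
  squeezing_radius D Omega1 a r ->
  squeezing_radius D Omega2 a ((al1 * al2) / (R1 * R2) * r).
Proof.
move=> n_gt0 open1 bnd1 bal1 ne1 open2 bnd2 bal2 ne2 al1 al2 R1 R2.
move=> al1_gt0 al2_gt0 R1_gt0 R2_gt0.
move=> [/andP[r_gt0 r_le1] [f [[fD finj fO] fa0 rf]]].
have al1R1 : al1 <= R1 by exact: dist_boundary_le_half_diam.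
have al2R2 : al2 <= R2 by exact: dist_boundary_le_half_diam.
have c_gt0 : 0 < al2 / R1 by rewrite divr_gt0.
have cC_neq0 : (al2 / R1)%:CC != 0 :> CC R.
  by rewrite -(rmorph0 (real_complex R)) (inj_eq (@complexI R)) gt_eqF.
split.
  have s_gt0 : 0 < (al1 * al2) / (R1 * R2) by apply: divr_gt0; exact: mulr_gt0.
  apply/andP; split; first exact: mulr_gt0.
  apply: mulr_ile1 => //; first exact: ltW.
  - exact: ltW.
  - rewrite ler_pdivrMr; last exact: mulr_gt0.
    by rewrite mul1r; apply: ler_pM => //; exact: ltW.
exists (fun x => (al2 / R1)%:CC *: f x); split.
- split.
  + by move=> z Dz; apply: differentiableZ; exact: fD.
  + by move=> x y Dx Dy /(scalerI cC_neq0); exact: finj.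
  + move=> _ [x Dx <-]; apply: mem_of_enorm_lt => //.
    have fx : enorm (f x) < R1.
      by apply: enorm_lt_half_diam => //; apply: fO; exists x.
    rewrite enormZ gtr0_norm// -/al2 mulrAC ltr_pdivrMr//.
    by rewrite ltr_pM2l.
- by rewrite fa0 scaler0.
- move=> z zs.
  have z_lt : enorm z < (al1 * al2) / (R1 * R2) * r * R2.
    exact: enorm_lt_of_minkowski_lt.
  have [x Dx fx] : (f @` D) ((al2 / R1)^-1%:CC *: z).
    apply: rf; apply: minkowski_lt => //.
    rewrite enormZ gtr0_norm ?invr_gt0// mulrC ltr_pdivrMr// -/al1.
    suff <- : (al1 * al2) / (R1 * R2) * r * R2 = r * al1 * (al2 / R1) by [].
    by field; rewrite !gt_eqF.
  exists x => //; rewrite fx scale_realA mulfV ?gt_eqF//.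
  by rewrite scale1r.
Qed.

(** If one of the four radii vanishes the constant is [0] (a quotient by [0]
    being [0]) and the bound is the nonnegativity of the squeezing function. *)
Lemma squeezing_comparison D Omega1 Omega2 : (0 < n)%N ->
  open Omega1 -> bounded_set Omega1 -> balanced Omega1 -> Omega1 !=set0 ->
  open Omega2 -> bounded_set Omega2 -> balanced Omega2 -> Omega2 !=set0 ->
  let al1 := set_dist 0 (set_boundary Omega1) in
  let al2 := set_dist 0 (set_boundary Omega2) in
  let R1 := 2^-1 * set_diam Omega1 in
  let R2 := 2^-1 * set_diam Omega2 in
  forall a,
  (al1 * al2) / (R1 * R2) * squeezing D Omega1 a <= squeezing D Omega2 a.
Proof.
move=> n_gt0 open1 bnd1 bal1 ne1 open2 bnd2 bal2 ne2 al1 al2 R1 R2 a.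
have half_diam_ge0 Omega : bounded_set Omega -> Omega !=set0 ->
    0 <= 2^-1 * set_diam Omega.
  move=> bnd [z Oz]; rewrite mulr_ge0 ?invr_ge0//.
  apply: (le_trans (enorm_ge0 (z - z))).
  by apply: ub_le_sup; [exact: has_ubound_diam|exists z, z].
have [c0|c_neq0] := eqVneq ((al1 * al2) / (R1 * R2)) 0.
  by rewrite c0 mul0r squeezing_ge0.
have al1_ge0 : 0 <= al1 by exact: set_dist_ge0.
have al2_ge0 : 0 <= al2 by exact: set_dist_ge0.
have R1_ge0 : 0 <= R1 by exact: half_diam_ge0.
have R2_ge0 : 0 <= R2 by exact: half_diam_ge0.
have c_gt0 : 0 < (al1 * al2) / (R1 * R2).
  by rewrite lt_def c_neq0; apply: divr_ge0; exact: mulr_ge0.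
move: c_neq0; rewrite mulf_eq0 invr_eq0 (mulf_eq0 al1) (mulf_eq0 R1) !negb_or.
move=> /andP[/andP[al1_neq0 al2_neq0] /andP[R1_neq0 R2_neq0]].
have [S0|/set0P S0] := eqVneq (squeezing_radius D Omega1 a) set0.
  rewrite {1}/squeezing -/(squeezing_radius D Omega1 a) S0 sup0 mulr0.
  exact: squeezing_ge0.
rewrite mulrC -ler_pdivlMr//; apply: ge_sup => // r r1.
rewrite ler_pdivlMr// mulrC; apply: ub_le_sup.
  by exists 1 => t [/andP[]].
have al1_gt0 : 0 < al1 by rewrite lt_def al1_neq0.
have al2_gt0 : 0 < al2 by rewrite lt_def al2_neq0.
have R1_gt0 : 0 < R1 by rewrite lt_def R1_neq0.
have R2_gt0 : 0 < R2 by rewrite lt_def R2_neq0.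
exact: squeezing_radius_transfer.
Qed.

End Comparison.

Theorem corollary2p3 (R : realType) (n : nat) (n_gt0 : (0 < n)%N)
  (D Omega1 Omega2 : set 'rV[CC R]_n)
  (domD : is_domain D) (bndD : bounded_set D)
  (dom1 : is_domain Omega1) (bnd1 : bounded_set Omega1)
  (bal1 : balanced Omega1) (cvx1 : convex_set Omega1)
  (dom2 : is_domain Omega2) (bnd2 : bounded_set Omega2)
  (bal2 : balanced Omega2) (cvx2 : convex_set Omega2) :
  let alpha1 := set_dist 0 (set_boundary Omega1) in
  let alpha2 := set_dist 0 (set_boundary Omega2) in
  let R1 := 2^-1 * set_diam Omega1 in
  let R2 := 2^-1 * set_diam Omega2 in
  forall a : 'rV[CC R]_n, D a ->
    squeezing D Omega2 a >=
      (alpha1 * alpha2) / (R1 * R2) * squeezing D Omega1 a /\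
    squeezing D Omega1 a >=
      (alpha1 * alpha2) / (R1 * R2) * squeezing D Omega2 a.
Proof.
move=> alpha1 alpha2 R1 R2 a _.
case: dom1 => ne1 open1 _; case: dom2 => ne2 open2 _.
split; first exact: squeezing_comparison.
by rewrite (mulrC alpha1) (mulrC R1); exact: squeezing_comparison.
Qed.
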